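(* Let $n\ge 4$ and let $\bar A,\bar B$ be real symmetric $n\times n$ matrices for which the weak interlacing property fails. Then for all real symmetric $n\times n$ matrices $A,B$, the weak interlacing property fails for the following pairs: 1. $(A+\mu\bar A,\ \bar B)$ and $(A+\beta\mu\bar A,\ B+\mu\bar B)$, for $\mu>0$ large enough and $\beta>0$; 2. $(A+\beta\bar B,\ B+\alpha\bar A)$, for $\alpha,\beta>0$ large enough.
   Context: All matrices are real and $\otimes$ is the Kronecker product. Let $T\in\mathbb{R}^{n^2\times n^2}$ be the commutation matrix, i.e. $T\operatorname{vec}(X)=\operatorname{vec}(X^\top)$ for all $X\in\mathbb{R}^{n\times n}$, where $\operatorname{vec}$ stacks columns. The weak interlacing property holds for a pair $(A,B)$ of symmetric $n\times n$ matrices if both $$\min_{Tu=u}\frac{u^\top(A\otimes B)u}{u^\top u}\le\min_{Tw=-w}\frac{w^\top(A\otimes B)w}{w^\top w}\quad\text{and}\quad\max_{Tw=-w}\frac{w^\top(A\otimes B)w}{w^\top w}\le\max_{Tu=u}\frac{u^\top(A\otimes B)u}{u^\top u}$$ hold, the optimizations being over nonzero vectors; it fails if at least one of the two inequalities is false. *)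

(* Defs.v *)
From HB Require Import structures.
From mathcomp Require Import all_boot all_order all_algebra.
From mathcomp Require Import all_classical all_reals.
From mathcomp Require Import mxtens.

Set Implicit Arguments.
Unset Strict Implicit.
Unset Printing Implicit Defensive.

Import Order.TTheory GRing.Theory Num.Theory.
Local Open Scope classical_set_scope.
Local Open Scope ring_scope.

(* Column stacking: entry X i j sits at position j * n + i, which is
   mxtens_index (j, i), the same indexing as that of the Kronecker product
   [tensmx]. (The library's [mxvec] stacks rows instead.) *)
Definition vec (R : Type) (n : nat) (X : 'M[R]_n) : 'cV[R]_(n * n) :=
  \col_k X (mxtens_unindex k).2 (mxtens_unindex k).1.

Definition swap_index (n : nat) (k : 'I_(n * n)) : 'I_(n * n) :=
  mxtens_index ((mxtens_unindex k).2, (mxtens_unindex k).1).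

Definition commutation_mx (R : pzRingType) (n : nat) : 'M[R]_(n * n) :=
  \matrix_(k, l) (l == swap_index k)%:R.

(* Since [vec] is onto, this property determines [commutation_mx]. *)
Lemma commutation_mxP (R : pzRingType) (n : nat) (X : 'M[R]_n) :
  commutation_mx R n *m vec X = vec X^T.
Proof.
apply/colP => k; rewrite !mxE (bigD1 (swap_index k)) //= big1 => [|l nl].
  by rewrite !mxE eqxx mul1r addr0 /swap_index mxtens_indexK.
by rewrite !mxE (negbTE nl) mul0r.
Qed.

(* The Kronecker product and [vec] use compatible conventions. *)
Lemma tensmx_vec (R : comPzRingType) (n : nat) (A B X : 'M[R]_n) :
  tensmx A B *m vec X = vec (B *m X *m A^T).
Proof.
apply/colP => k; case: (mxtens_indexP k) => i j.
rewrite !mxE mxtens_indexK /= (reindex (@mxtens_index n n)) /=; last first.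
  by exists (@mxtens_unindex n n) => l _; rewrite ?mxtens_indexK ?mxtens_unindexK.
transitivity (\sum_p \sum_q A i p * B j q * X q p).
  by rewrite pair_bigA; apply: eq_bigr => -[p q] _; rewrite tensmxE mxE mxtens_indexK.
apply: eq_bigr => p _; rewrite !mxE big_distrl; apply: eq_bigr => q _ /=.
by rewrite -mulrA mulrC.
Qed.

(* For a nonempty set with a least (greatest) element these are that element;
   they take the junk value 0 only if there is none, which does not occur for
   the values of a Rayleigh quotient on a nonzero subspace. *)
Definition minimum (R : realType) (S : set R) : R :=
  xget 0 [set m | S m /\ lbound S m].

Definition maximum (R : realType) (S : set R) : R :=
  xget 0 [set m | S m /\ ubound S m].

Definition rayleigh (R : realType) (m : nat) (M : 'M[R]_m) (u : 'cV[R]_m) : R :=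
  (u^T *m M *m u) 0 0 / (u^T *m u) 0 0.

Definition sym_values (R : realType) (n : nat) (A B : 'M[R]_n) : set R :=
  [set rayleigh (tensmx A B) u | u in
    [set u : 'cV[R]_(n * n) | u != 0 /\ commutation_mx R n *m u = u]].

Definition skew_values (R : realType) (n : nat) (A B : 'M[R]_n) : set R :=
  [set rayleigh (tensmx A B) w | w in
    [set w : 'cV[R]_(n * n) | w != 0 /\ commutation_mx R n *m w = - w]].

Definition weak_interlacing (R : realType) (n : nat) (A B : 'M[R]_n) : Prop :=
  minimum (sym_values A B) <= minimum (skew_values A B) /\
  maximum (skew_values A B) <= maximum (sym_values A B).

(* Main.v *)
Require Import Defs.
From mathcomp Require Import all_boot all_order all_algebra.
From mathcomp Require Import all_classical all_reals.
From mathcomp Require Import topology normedtype derive mxtens ring lra.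
Import Order.TTheory GRing.Theory Num.Theory.
Import numFieldNormedType.Exports.
Local Open Scope classical_set_scope.
Local Open Scope ring_scope.

(* Rayleigh quotients attain their extrema on a nonzero subspace, so weak
   interlacing fails for (A, B) exactly when some skew-symmetric vector beats
   all symmetric ones by a positive gap, for A (x) B or for its opposite. This
   survives small perturbations of A (x) B and positive scaling, and
     (A + a Abar) (x) (B + b Bbar)
       = a b (Abar (x) Bbar + A (x) Bbar / a + Abar (x) B / b + A (x) B / (a b)),
   whose last three terms are small for large a and b. Part 2 also uses that
   T (A (x) B) T = B (x) A, so that failure is symmetric in the pair. *)

(** * Rayleigh quotients: extrema on subspaces and boundedness *)

Lemma continuous_sum (R : realType) (U : topologicalType) (I : Type)
    (r : seq I) (F : I -> U -> R) :
  (forall i, continuous (F i)) -> continuous (fun x => \sum_(i <- r) F i x).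
Proof.
move=> cF; apply: (@continuous_big R I +%R 0 xpredT _ U r F) => //.
exact: add_continuous.
Qed.

Section RayleighQuotient.
Context {R : realType} {m : nat}.
Implicit Types (M N : 'M[R]_m) (u : 'cV[R]_m) (c : R).

Lemma sqnorm_gt0 u : u != 0 -> 0 < (u^T *m u) 0 0.
Proof.
move=> u_neq0; have [i ui] : exists i, u i 0 != 0.
  apply/existsP; rewrite -negb_forall; apply: contraNN u_neq0 => /forallP u0.
  by apply/eqP/colP => i; rewrite mxE; exact/eqP/u0.
rewrite mxE (bigD1 i) //= ltr_wpDr //; last by rewrite !mxE -expr2 exprn_even_gt0.
by apply: sumr_ge0 => j _; rewrite !mxE -expr2 sqr_ge0.
Qed.

Lemma rayleighD M N u : rayleigh (M + N) u = rayleigh M u + rayleigh N u.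
Proof. by rewrite /rayleigh mulmxDr mulmxDl mxE mulrDl. Qed.

Lemma rayleighZ c M u : rayleigh (c *: M) u = c * rayleigh M u.
Proof. by rewrite /rayleigh -scalemxAr -scalemxAl mxE mulrA. Qed.

Lemma rayleighN M u : rayleigh (- M) u = - rayleigh M u.
Proof. by rewrite -scaleN1r rayleighZ mulN1r. Qed.

Lemma quadratic_formZ c M u :
  ((c *: u)^T *m M *m (c *: u)) 0 0 = c ^+ 2 * (u^T *m M *m u) 0 0.
Proof.
have -> : (c *: u)^T = c *: u^T by apply/matrixP => i j; rewrite !mxE.
by rewrite -2!scalemxAl -scalemxAr scalerA mxE.
Qed.

Lemma sqnormZ c u : ((c *: u)^T *m (c *: u)) 0 0 = c ^+ 2 * (u^T *m u) 0 0.
Proof. by have := quadratic_formZ c 1%:M u; rewrite !mulmx1. Qed.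

Lemma rayleigh_scale c M u : c != 0 -> rayleigh M (c *: u) = rayleigh M u.
Proof.
move=> c0; rewrite /rayleigh quadratic_formZ sqnormZ -mulf_div divff ?mul1r //.
by rewrite expf_neq0.
Qed.

Lemma continuous_quadratic_form M :
  continuous (fun v : 'rV[R]_m => (v *m M *m v^T) 0 0).
Proof.
rewrite (_ : (fun _ => _) = fun v : 'rV[R]_m =>
    \sum_j (\sum_i v 0 i * M i j) * v 0 j); last first.
  by apply/funext => v; rewrite mxE; apply: eq_bigr => j _; rewrite !mxE.
apply: continuous_sum => j v; apply: continuousM; last exact: coord_continuous.
move: v; apply: continuous_sum => i v.
by apply: continuousM; [exact: coord_continuous|exact: cst_continuous].
Qed.

Lemma continuous_mulmx_tr_coord p (C : 'M[R]_(p, m)) k :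
  continuous (fun v : 'rV[R]_m => (C *m v^T) k 0).
Proof.
rewrite (_ : (fun _ => _) = fun v : 'rV[R]_m => \sum_i C k i * v 0 i); last first.
  by apply/funext => v; rewrite mxE; apply: eq_bigr => i _; rewrite mxE.
apply: continuous_sum => i v.
by apply: continuousM; [exact: cst_continuous|exact: coord_continuous].
Qed.

(** Extreme value theorem on the unit sphere of the kernel of [C]; the quotient is unchanged by
    scaling, so this covers all nonzero kernel vectors. With [C] equal to [T - 1%:M] or [T + 1%:M]
    the kernel is an eigenspace of [T]. *)
Lemma rayleigh_attains_min M p (C : 'M[R]_(p, m)) u0 :
    u0 != 0 -> C *m u0 = 0 ->
  exists v, [/\ v != 0, C *m v = 0 &
    forall u, u != 0 -> C *m u = 0 -> rayleigh M v <= rayleigh M u].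
Proof.
move=> u0_neq0 Cu0.
(* The unit sphere of the kernel, as row vectors because [rV_compact] is
   available for them only. *)
pose S : set 'rV[R]_m := [set v : 'rV[R]_m | forall i, `[-1, 1]%classic (v ord0 i)] `&`
  ((fun v : 'rV[R]_m => (v *m 1%:M *m v^T) 0 0) @^-1` [set x | x = 1] `&`
   \bigcap_(k in setT) ((fun v : 'rV[R]_m => (C *m v^T) k 0) @^-1` [set x | x = 0])).
(* The box is a product of segments, hence compact, and the other conditions are closed. Writing the
   squared norm with [1%:M] makes it a quadratic form, already known to be continuous. *)
have compactS : compact S.
  apply: compact_closedI.
    apply: (@rV_compact R m (fun=> `[-1, 1]%classic)) => _.
    exact: segment_compact.
  apply: closedI.
    apply: preimage_closed => [v _|]; last exact: closed_eq.
    exact: continuous_quadratic_form.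
  apply: closed_bigI => k _.
  apply: preimage_closed => [v _|]; last exact: closed_eq.
  exact: continuous_mulmx_tr_coord.
have normalize u : u != 0 -> C *m u = 0 ->
    exists2 c, c != 0 & S (c *: u)^T.
  move=> u_neq0 Cu; have q_gt0 := sqnorm_gt0 _ u_neq0.
  pose c := (Num.sqrt ((u^T *m u) 0 0))^-1.
  have c_neq0 : c != 0 by rewrite invr_neq0 // sqrtr_eq0 -ltNge.
  have cu1 : ((c *: u)^T *m (c *: u)) 0 0 = 1.
    by rewrite sqnormZ exprVn sqr_sqrtr ?ltW // mulVf // gt_eqF.
  exists c => //; split; last first.
    split; first by rewrite /= mulmx1 trmxK.
    by move=> k _ /=; rewrite trmxK -scalemxAr Cu scaler0 mxE.
  (* A unit vector lies in the box: each squared coordinate is one term of a sum of squares equal to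
     1. *)
  move=> i /=; rewrite in_itv /= -ler_norml -(@ler_pXn2r _ 2) ?nnegrE //.
  rewrite expr1n real_normK ?num_real // -cu1 [leRHS]mxE (bigD1 i) //= !mxE -expr2.
  by rewrite lerDl sumr_ge0 // => j _; rewrite !mxE -expr2 sqr_ge0.
have rayleighS v : S v -> rayleigh M v^T = (v *m M *m v^T) 0 0.
  by move=> [_ [v1 _]]; move: v1; rewrite /rayleigh /= trmxK mulmx1 => ->;
    rewrite divr1.
have [] := @compact_EVT_min 'rV[R]_m R (fun v => (v *m M *m v^T) 0 0) S _ compactS.
- by have [c _ Su] := normalize _ u0_neq0 Cu0; exists (c *: u0)^T.
- exact/continuous_subspaceT/continuous_quadratic_form.
move=> v; rewrite inE => Sv minv; exists v^T; case: (Sv) => [_ [/= v1 Cv]].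
split.
- apply/negP => /eqP v0; move: v1; rewrite v0 mulmx0 mxE => /eqP.
  by rewrite eq_sym oner_eq0.
- by apply/colP => k; rewrite [RHS]mxE; exact: Cv.
move=> u u_neq0 Cu; have [c c_neq0 Scu] := normalize _ u_neq0 Cu.
rewrite -(rayleigh_scale _ M u c_neq0) -[X in _ <= rayleigh M X]trmxK.
by rewrite !rayleighS //; apply: minv; rewrite inE.
Qed.

Lemma rayleigh_attains_max M p (C : 'M[R]_(p, m)) u0 :
    u0 != 0 -> C *m u0 = 0 ->
  exists v, [/\ v != 0, C *m v = 0 &
    forall u, u != 0 -> C *m u = 0 -> rayleigh M u <= rayleigh M v].
Proof.
move=> u0_neq0 Cu0; have [v [v0 Cv minv]] := rayleigh_attains_min (- M) _ C _ u0_neq0 Cu0.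
exists v; split=> // u u_neq0 Cu; rewrite -lerN2 -!rayleighN; exact: minv.
Qed.

(** The zero constraint matrix has the whole space as kernel, so both extrema are attained there.
    The bounds control the error terms of the perturbation. *)
Lemma rayleigh_bounded M :
  exists2 K, 0 < K & forall u, u != 0 -> `|rayleigh M u| <= K.
Proof.
have [[u0 u0_neq0]|no_u] := pselect (exists u, u != 0); last first.
  (* Dimension zero: there is no nonzero vector to bound. *)
  by exists 1 => // u u_neq0; case: no_u; exists u.
have [v [_ _ minv]] := rayleigh_attains_min M _ (0 : 'M_m) _ u0_neq0 (mul0mx _ _).
have [w [_ _ maxw]] := rayleigh_attains_max M _ (0 : 'M_m) _ u0_neq0 (mul0mx _ _).
exists (`|rayleigh M v| + `|rayleigh M w| + 1) => [|u u_neq0].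
  by rewrite ltr_wpDl // addr_ge0.
have := minv u u_neq0 (mul0mx _ _); have := maxw u u_neq0 (mul0mx _ _).
have := ler_norm (rayleigh M w); have := lerNnormlW (lexx `|rayleigh M v|).
have := normr_ge0 (rayleigh M v); have := normr_ge0 (rayleigh M w).
by rewrite ler_norml => *; apply/andP; split; lra.
Qed.

End RayleighQuotient.

(** * Failure of weak interlacing as a gap *)

Lemma minimumE (R : realType) (S : set R) x : S x -> lbound S x -> minimum S = x.
Proof.
move=> Sx lbx; apply: xget_unique => // y [Sy lby].
by apply/le_anti; rewrite lbx ?lby.
Qed.

Lemma maximumE (R : realType) (S : set R) x : S x -> ubound S x -> maximum S = x.
Proof.
move=> Sx ubx; apply: xget_unique => // y [Sy uby].
by apply/le_anti; rewrite uby ?ubx.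
Qed.

Section Interlacing.
Context {R : realType} {n : nat}.
Implicit Types (A B : 'M[R]_n) (M F : 'M[R]_(n * n)).

Local Notation T := (commutation_mx R n).

(* The gap [d] makes the failure of the first inequality visibly an open
   condition on [M]; applied to [- M] it expresses failure of the second. *)
Definition skew_dips M := exists w d,
  [/\ w != 0, T *m w = - w, 0 < d &
   forall u, u != 0 -> T *m u = u -> rayleigh M w + d <= rayleigh M u].

Lemma vec_neq0 (X : 'M[R]_n) i j : X i j != 0 -> vec X != 0.
Proof.
apply: contraNneq => /colP/(_ (mxtens_index (j, i))).
by rewrite !mxE mxtens_indexK => ->.
Qed.

Lemma sym_vector_exists : (1 < n)%N ->
  exists2 u : 'cV[R]_(n * n), u != 0 & T *m u = u.
Proof.
move=> n_gt1; pose i := Ordinal (ltnW n_gt1).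
exists (vec 1%:M); last by rewrite commutation_mxP trmx1.
by apply: (@vec_neq0 _ i i); rewrite mxE eqxx oner_neq0.
Qed.

Lemma skew_vector_exists : (1 < n)%N ->
  exists2 w : 'cV[R]_(n * n), w != 0 & T *m w = - w.
Proof.
move=> n_gt1; pose i := Ordinal (ltnW n_gt1); pose j := Ordinal n_gt1.
pose X : 'M[R]_n := delta_mx i j - delta_mx j i.
have vecN : vec (- X) = - vec X by apply/colP => k; rewrite !mxE.
exists (vec X).
  by apply: (@vec_neq0 _ i j); rewrite !mxE eqxx subr0 oner_neq0.
by rewrite commutation_mxP -vecN /X linearB /= !trmx_delta opprB.
Qed.

Lemma kermx_subr1 (u : 'cV[R]_(n * n)) : (T - 1%:M) *m u = 0 <-> T *m u = u.
Proof.
by rewrite mulmxBl mul1mx; split=> [/subr0_eq|->] //; rewrite subrr.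
Qed.

Lemma kermx_addr1 (u : 'cV[R]_(n * n)) : (T + 1%:M) *m u = 0 <-> T *m u = - u.
Proof.
by rewrite mulmxDl mul1mx; split=> [/eqP|->]; [rewrite addr_eq0 => /eqP|rewrite addNr].
Qed.

(** Since both minima are attained, at [v] and [w], their difference serves as the gap. *)
Lemma skew_dipsP M v w : v != 0 -> T *m v = v -> w != 0 -> T *m w = - w ->
    (forall u, u != 0 -> T *m u = u -> rayleigh M v <= rayleigh M u) ->
    (forall u, u != 0 -> T *m u = - u -> rayleigh M w <= rayleigh M u) ->
  skew_dips M <-> rayleigh M w < rayleigh M v.
Proof.
move=> v0 Tv w0 Tw minv minw; split=> [[x [d [x0 Tx d0 dips]]]|ltwv].
  by have := minw x x0 Tx; have := dips v v0 Tv; lra.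
exists w, (rayleigh M v - rayleigh M w); split=> //; first by rewrite subr_gt0.
by move=> u u0 Tu; rewrite addrC subrK minv.
Qed.

Lemma skew_dips_minimum A B : (1 < n)%N ->
  skew_dips (tensmx A B) <-> minimum (skew_values A B) < minimum (sym_values A B).
Proof.
move=> n_gt1; have [u0 u0_neq0 /kermx_subr1 Tu0] := sym_vector_exists n_gt1.
have [w0 w0_neq0 /kermx_addr1 Tw0] := skew_vector_exists n_gt1.
have [v [v_neq0 /kermx_subr1 Tv minv]] :=
  rayleigh_attains_min (tensmx A B) _ _ _ u0_neq0 Tu0.
have [w [w_neq0 /kermx_addr1 Tw minw]] :=
  rayleigh_attains_min (tensmx A B) _ _ _ w0_neq0 Tw0.
rewrite (@minimumE _ (sym_values A B) (rayleigh (tensmx A B) v)); last 2 first.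
- by exists v.
- by move=> _ [u [u_neq0 /kermx_subr1 Tu] <-]; exact: minv.
rewrite (@minimumE _ (skew_values A B) (rayleigh (tensmx A B) w)); last 2 first.
- by exists w.
- by move=> _ [u [u_neq0 /kermx_addr1 Tu] <-]; exact: minw.
apply: skew_dipsP => // u u_neq0 Tu.
  by apply: minv => //; exact/kermx_subr1.
by apply: minw => //; exact/kermx_addr1.
Qed.

Lemma skew_dips_maximum A B : (1 < n)%N ->
  skew_dips (- tensmx A B) <-> maximum (sym_values A B) < maximum (skew_values A B).
Proof.
move=> n_gt1; have [u0 u0_neq0 /kermx_subr1 Tu0] := sym_vector_exists n_gt1.
have [w0 w0_neq0 /kermx_addr1 Tw0] := skew_vector_exists n_gt1.
have [v [v_neq0 /kermx_subr1 Tv maxv]] :=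
  rayleigh_attains_max (tensmx A B) _ _ _ u0_neq0 Tu0.
have [w [w_neq0 /kermx_addr1 Tw maxw]] :=
  rayleigh_attains_max (tensmx A B) _ _ _ w0_neq0 Tw0.
rewrite (@maximumE _ (sym_values A B) (rayleigh (tensmx A B) v)); last 2 first.
- by exists v.
- by move=> _ [u [u_neq0 /kermx_subr1 Tu] <-]; exact: maxv.
rewrite (@maximumE _ (skew_values A B) (rayleigh (tensmx A B) w)); last 2 first.
- by exists w.
- by move=> _ [u [u_neq0 /kermx_addr1 Tu] <-]; exact: maxw.
(* The maximizers of the quotient are minimizers for the opposite matrix. *)
rewrite -ltrN2 -!rayleighN.
apply: skew_dipsP => // u u_neq0 Tu; rewrite !rayleighN lerN2.
  by apply: maxv => //; exact/kermx_subr1.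
by apply: maxw => //; exact/kermx_addr1.
Qed.

Lemma not_weak_interlacingP A B : (1 < n)%N ->
  ~ weak_interlacing A B <-> skew_dips (tensmx A B) \/ skew_dips (- tensmx A B).
Proof.
move=> n_gt1; have min := skew_dips_minimum A B n_gt1.
have max := skew_dips_maximum A B n_gt1; split.
  move=> /not_andP[] /negP; rewrite -ltNge => lt; first by left; exact/min.
  by right; exact/max.
by case=> [/min|/max]; rewrite ltNge => /negP nle []; do ?move=> ? ?; apply: nle.
Qed.

(** * Perturbation and scaling *)

Lemma skew_dips_stable M : skew_dips M ->
  exists2 e, 0 < e & forall c F, 0 < c ->
    (forall u, u != 0 -> `|rayleigh F u| <= e) -> skew_dips (c *: (M + F)).
Proof.
(* [F] shifts each of the two compared quotients by at most [d / 3], so a third of the gap survives,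
   multiplied by [c]. *)
move=> [w [d [w0 Tw d0 dips]]]; exists (d / 3) => [|c F c0 Fe]; first lra.
exists w, (c * (d / 3)); split=> //; first by rewrite mulr_gt0 //; lra.
move=> u u0 Tu; rewrite !rayleighZ -mulrDr ler_pM2l // !rayleighD.
have := dips u u0 Tu; have := Fe u u0; have := Fe w w0.
by rewrite !ler_norml => /andP[? ?] /andP[? ?]; lra.
Qed.

(** The radius [e] depends only on [A] and [B]. If the second inequality is the one that fails, the
    opposite matrix is perturbed by [- F], which obeys the same bound. *)
Lemma not_weak_interlacing_stable A B : (1 < n)%N -> ~ weak_interlacing A B ->
  exists2 e, 0 < e & forall A' B' c F, 0 < c ->
    (forall u, u != 0 -> `|rayleigh F u| <= e) ->
    tensmx A' B' = c *: (tensmx A B + F) -> ~ weak_interlacing A' B'.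
Proof.
move=> n_gt1 /(not_weak_interlacingP _ _ n_gt1)[] /skew_dips_stable[e e0 stable];
  exists e => // A' B' c F c0 Fe AB'; apply/not_weak_interlacingP => //.
  by left; rewrite AB'; exact: stable.
right; rewrite AB' -scalerN opprD; apply: stable => // u u0.
by rewrite rayleighN normrN Fe.
Qed.

Lemma mxtens_matrixP M F :
  (forall i j k l, M (mxtens_index (i, j)) (mxtens_index (k, l)) =
                   F (mxtens_index (i, j)) (mxtens_index (k, l))) -> M = F.
Proof.
move=> MF; apply/matrixP => p q.
by case: (mxtens_indexP p) => i j; case: (mxtens_indexP q) => k l; exact: MF.
Qed.

Lemma not_weak_interlacing_scaler A B c : (1 < n)%N -> 0 < c ->
  ~ weak_interlacing A (c *: B) -> ~ weak_interlacing A B.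
Proof.
move=> n_gt1 c0 /(not_weak_interlacing_stable _ _ n_gt1)[e e0 stable].
apply: (stable A B c^-1 0); first by rewrite invr_gt0.
  (* The perturbation is zero; writing it as [0 *: 0] shows that its quotient vanishes. *)
  by move=> u _; rewrite -(scale0r 0) rayleighZ mul0r normr0 ltW.
apply: mxtens_matrixP => i j k l.
by rewrite addr0 tensmxE [RHS]mxE tensmxE !mxE; field; rewrite gt_eqF.
Qed.

(** All three families of pairs reduce to this, because [a] and [b] vary independently above the
    threshold. *)
Lemma not_weak_interlacing_large (A B Abar Bbar : 'M[R]_n) : (1 < n)%N ->
    ~ weak_interlacing Abar Bbar ->
  exists2 t, 0 < t & forall a b, t <= a -> t <= b ->
    ~ weak_interlacing (A + a *: Abar) (B + b *: Bbar).
Proof.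
move=> n_gt1 /(not_weak_interlacing_stable _ _ n_gt1)[e e0 stable].
have [K1 K1_gt0 K1P] := rayleigh_bounded (tensmx A Bbar).
have [K2 K2_gt0 K2P] := rayleigh_bounded (tensmx Abar B).
have [K3 K3_gt0 K3P] := rayleigh_bounded (tensmx A B).
(* For [a] and [b] at least [t], the three error coefficients are at most [t^-1], so the error is at
   most [(K1 + K2 + K3) / t], which is at most [e]. The summand 1 gives [1 <= t], needed for the
   coefficient [a^-1 * b^-1]. *)
pose t := 1 + (K1 + K2 + K3) / e.
have t1 : 1 <= t by rewrite lerDl ltW // divr_gt0 // !addr_gt0.
exists t => [|a b ta tb]; first lra.
have a_gt0 : 0 < a by lra.
have b_gt0 : 0 < b by lra.
apply: (stable _ _ (a * b) (a^-1 *: tensmx A Bbar + b^-1 *: tensmx Abar B +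
    (a^-1 * b^-1) *: tensmx A B)); first exact: mulr_gt0.
  move=> u u0; have t_gt0 : 0 < t by lra.
  have inv_le x : t <= x -> x^-1 <= t^-1.
    by move=> tx; rewrite lef_pV2 // posrE; lra.
  have inv_ge0 x : t <= x -> 0 <= x^-1 by move=> tx; rewrite invr_ge0; lra.
  have tinv1 : t^-1 <= 1 by rewrite invf_le1.
  have Kt : t^-1 * (K1 + K2 + K3) <= e.
    by rewrite ler_pdivrMl // /t mulrDl mul1r divfK ?gt_eqF // lerDr ltW.
  have term x r K : 0 <= x -> x <= t^-1 -> `|r| <= K -> `|x * r| <= t^-1 * K.
    by move=> x0 xt rK; rewrite normrM ger0_norm // ler_pM.
  apply: le_trans Kt; rewrite !mulrDr !rayleighD !rayleighZ.
  apply: le_trans (ler_normD _ _) _; apply: lerD.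
    apply: le_trans (ler_normD _ _) _; apply: lerD.
      by apply: term; [exact: inv_ge0|exact: inv_le|exact: K1P].
    by apply: term; [exact: inv_ge0|exact: inv_le|exact: K2P].
  apply: term; [by rewrite mulr_ge0 ?inv_ge0| |exact: K3P].
  rewrite -[leRHS]mulr1 ler_pM ?inv_ge0 ?inv_le //.
  exact: le_trans (inv_le _ tb) tinv1.
apply: mxtens_matrixP => i j k l.
have addE (M N : 'M[R]_(n * n)) p q : (M + N) p q = M p q + N p q by rewrite mxE.
have scaleE x (M : 'M[R]_(n * n)) p q : (x *: M) p q = x * M p q by rewrite mxE.
by rewrite !(scaleE, addE) !tensmxE !mxE; field; rewrite !gt_eqF.
Qed.

(** * Exchanging the two Kronecker factors *)

Lemma swap_index_mxtens (i j : 'I_n) :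
  swap_index (mxtens_index (i, j)) = mxtens_index (j, i).
Proof. by rewrite /swap_index mxtens_indexK. Qed.

Lemma swap_indexK : involutive (@swap_index n).
Proof. by move=> k; case: (mxtens_indexP k) => i j; rewrite !swap_index_mxtens. Qed.

(** [T] is a symmetric involution, hence orthogonal, so applying it to [u] preserves the
    denominator. *)
Lemma rayleigh_tensmxC A B (u : 'cV[R]_(n * n)) :
  rayleigh (tensmx A B) u = rayleigh (tensmx B A) (T *m u).
Proof.
have Tmul p (N : 'M[R]_(n * n, p)) : T *m N = \matrix_(k, l) N (swap_index k) l.
  apply/matrixP => k l; rewrite !mxE (bigD1 (swap_index k)) //= big1 ?addr0.
    by rewrite !mxE eqxx mul1r.
  by move=> q /negbTE nq; rewrite mxE nq mul0r.
have Ttr : T^T = T.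
  by apply/matrixP => k l; rewrite !mxE eq_sym (can2_eq swap_indexK swap_indexK).
have TT : T *m T = 1%:M.
  by apply/matrixP => k l; rewrite Tmul !mxE swap_indexK eq_sym.
(* Conjugation by [T] exchanges the Kronecker factors. *)
have TBAT : T *m tensmx B A *m T = tensmx A B.
  (* [Tmul] describes left multiplication as a permutation of rows; transposing brings the right
     factor to the left. *)
  have -> : T *m tensmx B A *m T = (T *m (T *m tensmx B A)^T)^T.
    by rewrite trmx_mul trmxK Ttr.
  apply: mxtens_matrixP => i j k l.
  by rewrite mxE Tmul mxE [LHS]mxE Tmul mxE !swap_index_mxtens !tensmxE mulrC.
by rewrite /rayleigh trmx_mul Ttr -TBAT !mulmxA -(mulmxA u^T T T) TT mulmx1.
Qed.

(** On each eigenspace [T] acts as a sign, which the quotient ignores, so both sets of values are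
    the same for the two orders. *)
Lemma weak_interlacingC A B : weak_interlacing A B -> weak_interlacing B A.
Proof.
have rayleighNr M u : rayleigh M (- u) = rayleigh M u.
  by rewrite -scaleN1r rayleigh_scale // oppr_eq0 oner_neq0.
have symE : sym_values A B = sym_values B A.
  by apply/seteqP; split=> _ [u [u0 Tu] <-]; exists u => //;
    rewrite [RHS]rayleigh_tensmxC Tu.
have skewE : skew_values A B = skew_values B A.
  by apply/seteqP; split=> _ [u [u0 Tu] <-]; exists u => //;
    rewrite [RHS]rayleigh_tensmxC Tu rayleighNr.
by rewrite /weak_interlacing symE skewE.
Qed.

End Interlacing.

Theorem theorem13 (R : realType) (n : nat) (hn : (4 <= n)%N)
  (Abar Bbar : 'M[R]_n) (hAbar : Abar^T = Abar) (hBbar : Bbar^T = Bbar)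
  (hfail : ~ weak_interlacing Abar Bbar)
  (A B : 'M[R]_n) (hA : A^T = A) (hB : B^T = B) :
  ((exists2 mu0 : R, 0 < mu0 & forall mu : R, mu0 <= mu ->
      ~ weak_interlacing (A + mu *: Abar) Bbar) /\
   (forall beta : R, 0 < beta ->
      exists2 mu0 : R, 0 < mu0 & forall mu : R, mu0 <= mu ->
      ~ weak_interlacing (A + (beta * mu) *: Abar) (B + mu *: Bbar))) /\
  (exists2 alpha0 : R, 0 < alpha0 & exists2 beta0 : R, 0 < beta0 &
      forall alpha beta : R, alpha0 <= alpha -> beta0 <= beta ->
      ~ weak_interlacing (A + beta *: Bbar) (B + alpha *: Abar)).
Proof.
have n_gt1 : (1 < n)%N by exact: leq_trans hn.
split; [split|].
(* With zero as the second fixed matrix and [b = t], the second factor is [t *: Bbar], whose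
   positive scalar can be removed. *)
- have [t t_gt0 fails] := not_weak_interlacing_large A 0 _ _ n_gt1 hfail.
  exists t => // mu tmu; apply: (not_weak_interlacing_scaler _ _ t n_gt1 t_gt0).
  by rewrite -[t *: Bbar]add0r; exact: fails.
- move=> beta beta_gt0.
  have [t t_gt0 fails] := not_weak_interlacing_large A B _ _ n_gt1 hfail.
  have tb_gt0 : 0 < t / beta by exact: divr_gt0.
  (* Both summands are positive, so [mu] and [beta * mu] are each at least [t]. *)
  exists (t + t / beta) => [|mu tmu]; first lra.
  apply: fails; last lra.
  by rewrite mulrC -ler_pdivrMr //; lra.
(* Here [Bbar] perturbs the first factor and [Abar] the second, so failure is needed for the
   exchanged pair. *)
- have fail_swap : ~ weak_interlacing Bbar Abar by move=> /weak_interlacingC.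
  have [t t_gt0 fails] := not_weak_interlacing_large A B _ _ n_gt1 fail_swap.
  by exists t => //; exists t => // alpha beta ta tb; exact: fails.
Qed.
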